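(* For any group $X$ with neutral element $e$, the map $$\Phi:\mathsf P^2(X)\to\mathrm{End}(\mathsf P(X)),\qquad \Phi:\mathcal A\mapsto\Phi_{\mathcal A},\qquad \Phi_{\mathcal A}(A)=\{x\in X:x^{-1}A\in\mathcal A\}\quad(A\subset X),$$ is a topological isomorphism (a semigroup isomorphism that is a homeomorphism), with inverse $\Phi^{-1}:\varphi\mapsto\{A\subset X:e\in\varphi(A)\}$.
   Context: $\mathsf P(X)$ is the power-set of $X$ with the compact Hausdorff topology of $\{0,1\}^X$, and $\mathsf P^2(X)=\mathsf P(\mathsf P(X))$ is the double power-set with the compact Hausdorff topology of $\{0,1\}^{\mathsf P(X)}$ and the binary operation $\mathcal A\circ\mathcal B=\{A\subset X:\{x\in X:x^{-1}A\in\mathcal B\}\in\mathcal A\}$. The group $X$ acts on $\mathsf P(X)$ by $(x,A)\mapsto xA=\{xa:a\in A\}$. $\mathrm{End}(\mathsf P(X))$ is the set of all equivariant functions $\varphi:\mathsf P(X)\to\mathsf P(X)$, i.e. $\varphi(xA)=x\varphi(A)$ for all $x\in X$, $A\subset X$, with composition of functions as operation and the subspace topology inherited from the Tychonoff power $\mathsf P(X)^{\mathsf P(X)}$. *)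

(* Defs.v *)
From HB Require Import structures.
From mathcomp Require Import all_boot all_order all_algebra.
From mathcomp Require Import all_classical all_reals all_analysis.

Set Implicit Arguments.
Unset Strict Implicit.
Unset Printing Implicit Defensive.

Local Open Scope classical_set_scope.
Local Open Scope group_scope.

(* A subset of [T] is a [set T], i.e. a predicate [T -> Prop]; its topology is
   that of {0,1}^T, transported along the bijection sending a subset to its
   characteristic function ([bool] carries the discrete topology). *)
Definition powset (T : Type) : Type := set T.

Definition powset_char (T : Type) (A : powset T) : {ptws T -> bool} :=
  fun x => `[< A x >].

HB.instance Definition _ (T : Type) :=
  Topological.copy (powset T) (initial_topology (@powset_char T)).

Definition translate (X : groupType) (x : X) (A : powset X) : powset X :=
  [set x * a | a in A].

Definition dpowset (X : Type) : Type := powset (powset X).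

HB.instance Definition _ (X : Type) :=
  Topological.copy (dpowset X) (powset (powset X)).

Definition dpowset_mul (X : groupType) (A B : dpowset X) : dpowset X :=
  [set S | A [set x | B (translate x^-1 S)]].

Lemma translateE (X : groupType) (x y : X) (A : powset X) :
  translate x A y = A (x^-1 * y).
Proof.
apply/propext; split=> [[a Aa <-]|Ay]; first by rewrite mulKg.
by exists (x^-1 * y) => //; rewrite mulVKg.
Qed.

Lemma translateM (X : groupType) (x y : X) (A : powset X) :
  translate x (translate y A) = translate (x * y) A.
Proof. by apply/funext => z; rewrite !translateE invgM mulgA. Qed.

Lemma translate_preimage (X : groupType) (B : dpowset X) (x : X) (S : powset X) :
  translate x [set y | B (translate y^-1 S)] =
  [set y | B (translate y^-1 (translate x S))].
Proof.
by apply/funext => y; rewrite translateE /= translateM invgM invgK.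
Qed.

Lemma dpowset_mulA (X : groupType) : associative (@dpowset_mul X).
Proof.
move=> A B C; apply/funext => S; rewrite /dpowset_mul /=; congr (A _).
by apply/funext => x; congr (B _); rewrite translate_preimage.
Qed.

HB.instance Definition _ (X : groupType) :=
  isSemigroup.Build (dpowset X) (@dpowset_mulA X).

Definition equivariant (X : groupType) : set {ptws powset X -> powset X} :=
  [set phi | forall x A, phi (translate x A) = translate x (phi A)].

(* [set_type] is the subtype attached to a set; it carries the subspace
   topology. *)
Definition EndP (X : groupType) : Type := set_type (@equivariant X).

HB.instance Definition _ (X : groupType) :=
  Topological.copy (EndP X) (set_type (@equivariant X)).

Lemma EndP_equivariant (X : groupType) (f : EndP X) : equivariant (val f).
Proof. exact: set_valP. Qed.

Lemma EndP_comp_subproof (X : groupType) (f g : EndP X) :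
  (val f \o val g : {ptws powset X -> powset X}) \in @equivariant X.
Proof.
by apply/mem_set => x A /=; rewrite (EndP_equivariant g) (EndP_equivariant f).
Qed.

Definition EndP_comp (X : groupType) (f g : EndP X) : EndP X :=
  exist _ (val f \o val g) (EndP_comp_subproof f g).

Lemma EndP_compA (X : groupType) : associative (@EndP_comp X).
Proof. by move=> f g h; apply: val_inj. Qed.

HB.instance Definition _ (X : groupType) :=
  isSemigroup.Build (EndP X) (@EndP_compA X).

Definition Phi_fun (X : groupType) (A : dpowset X) :
    {ptws powset X -> powset X} :=
  fun S => [set x | A (translate x^-1 S)].

Lemma Phi_subproof (X : groupType) (A : dpowset X) :
  Phi_fun A \in @equivariant X.
Proof. by apply/mem_set => x S; apply/esym/translate_preimage. Qed.

Definition Phi (X : groupType) (A : dpowset X) : EndP X :=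
  exist _ (Phi_fun A) (Phi_subproof A).

Definition Phi_inv (X : groupType) (f : EndP X) : dpowset X :=
  [set S | val f S 1].

(* Main.v *)
(* An equivariant phi is determined by the sets A with e in phi(A), because
   x in phi(A) iff e in phi(x^-1 A).  Both Phi and its inverse are continuous
   because each {0,1}-coordinate of their value is a coordinate of the argument:
   the coordinate (S, x) of Phi(A) is the coordinate x^-1 S of A, and the
   coordinate S of Phi^-1(phi) is the coordinate (S, e) of phi. *)
Require Import Defs.
From HB Require Import structures.
From mathcomp Require Import all_boot all_order all_algebra.
From mathcomp Require Import all_classical all_reals all_analysis.

Local Open Scope classical_set_scope.

(** The pointwise topology is the supremum of the initial topologies of the evaluations at each
    [i]. *)
Lemma ptws_continuousP (Z : topologicalType) (I : Type) (Y : topologicalType)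
    (f : Z -> {ptws I -> Y}) :
  continuous f <-> forall i, continuous (fun z => f z i).
Proof.
split=> [cf i z|cf z].
  apply: (@cvg_comp _ _ _ f (fun g => g i) _ _ _ (cf z)) => U fzU.
  have /cvg_sup/(_ i) evf : f z --> f z by exact: cvg_id.
  exact/evf/(@initial_continuous _ Y (fun g : I -> Y => g i)).
apply/cvg_sup => i.
exact: (@continuous_comp_initial _ _ _ (fun g : I -> Y => g i) f (cf i) z).
Qed.

Lemma powset_continuousP (Z : topologicalType) (T : Type) (f : Z -> powset T) :
  continuous f <-> forall t, continuous (fun z => `[< f z t >] : bool).
Proof.
rewrite -(ptws_continuousP _ _ _ (@powset_char T \o f)); split=> cf.
  move=> z; apply: cvg_comp; first exact: cf.
  exact: (@initial_continuous _ _ (@powset_char T)).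
exact: (@continuous_comp_initial _ _ _ (@powset_char T)).
Qed.

(** The subspace topology is initial for the inclusion [set_val], so two layers of coordinates
    remain: first [A], then [x]. *)
Lemma EndP_continuousP (Z : topologicalType) (X : groupType) (f : Z -> EndP X) :
  continuous f <->
  forall A x, continuous (fun z => `[< val (f z) A x >] : bool).
Proof.
have -> : continuous f <->
    continuous (fun z => val (f z) : {ptws powset X -> powset X}).
  split=> cf; last exact: (@continuous_comp_initial _ _ _ set_val).
  move=> z; apply: cvg_comp; first exact: cf.
  exact: (@initial_continuous _ _ set_val).
rewrite ptws_continuousP.
by split=> cf A; [exact/powset_continuousP|exact/powset_continuousP/cf].
Qed.

Theorem theorem4p1 (X : groupType) :
  [/\ {morph @Phi X : A B / (A * B)%g >-> (A * B)%g},
      cancel (@Phi X) (@Phi_inv X),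
      cancel (@Phi_inv X) (@Phi X),
      continuous (@Phi X)
    & continuous (@Phi_inv X)].
Proof.
have translate1 (A : powset X) : translate 1%g A = A.
  by apply/funext => x; rewrite translateE invg1 mul1g.
split.
- move=> A B; apply: val_inj; apply/funext => S; apply/funext => x /=.
  (* Both sides test [A], on sets that agree because [Phi B] is equivariant. *)
  by congr (A _); rewrite translate_preimage.
- move=> A; apply/funext => S.
  by rewrite /Phi_inv /= /Phi_fun /= invg1 translate1.
- move=> f; apply: val_inj; apply/funext => S; apply/funext => x /=.
  by rewrite /Phi_fun /Phi_inv /= EndP_equivariant translateE invgK mulg1.
- apply/EndP_continuousP => S x.
  (* For the identity, the criterion says that all coordinates are continuous; the required one is
     found by conversion. *)
  have /powset_continuousP : continuous (@id (dpowset X)).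
    by move=> A; exact: cvg_id.
  exact.
- apply/powset_continuousP => S.
  have /EndP_continuousP : continuous (@id (EndP X)).
    by move=> f; exact: cvg_id.
  exact.
Qed.
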